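(* Let $\mathcal H$ and $\mathcal K$ be real or complex Hilbert spaces and let $A,B:\mathcal K\to\mathcal H$ be (not necessarily densely defined or closable) linear operators such that $\operatorname{dom}B\subset\operatorname{dom}A$. The following statements are equivalent: (i) there exists a positive self-adjoint operator $S$ such that $SA\supseteq B$; (ii) $\langle Bh,Ah\rangle\ge0$ for every $h\in\operatorname{dom}B$, and the set of those vectors $g$ such that $$\sup\{|\langle Bh,g\rangle|:\ h\in\operatorname{dom}B,\ \langle Bh,Ah\rangle\le1\}<+\infty$$ is dense in $\mathcal H$; (iii) for every sequence $(h_n)_{n\in\mathbb N}$ of $\operatorname{dom}B$ such that $\langle Bh_n,Ah_n\rangle\to0$ and $Bh_n\to f$, it follows that $f=0$.
   Context: A linear operator $A:\mathcal K\to\mathcal H$ is a linear map from a linear subspace $\operatorname{dom}A\subseteq\mathcal K$ into $\mathcal H$. An operator $S:\mathcal H\to\mathcal H$ is symmetric if $\langle Sf,g\rangle=\langle f,Sg\rangle$ for all $f,g\in\operatorname{dom}S$, positive if it is symmetric and $\langle Sf,f\rangle\ge0$ for all $f\in\operatorname{dom}S$, and self-adjoint if it is densely defined and $S^*=S$. The product $SA$ has domain $\{x\in\operatorname{dom}A: Ax\in\operatorname{dom}S\}$, and $SA\supseteq B$ means that $\operatorname{dom}B\subseteq\operatorname{dom}(SA)$ and $SAx=Bx$ for all $x\in\operatorname{dom}B$.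
   Formalization: Condition (iii) is supplemented by ⟨Bh,Ah⟩≥0 on dom B (else A=−I, B=I is a counterexample), and over real scalars (i) is equivalent to (ii) together with ⟨Bh,Ak⟩=⟨Ah,Bk⟩ on dom B (else A=I, B=[[1,−1],[1,1]] on R² is one). *)

(* Defs.v *)
From HB Require Import structures.
From mathcomp Require Import all_boot all_order all_algebra sesquilinear.
From mathcomp Require Import complex.
From mathcomp Require Import boolp classical_sets reals topology normedtype.

Set Implicit Arguments.
Unset Strict Implicit.
Unset Printing Implicit Defensive.
Import Order.TTheory GRing.Theory Num.Theory.
Import numFieldNormedType.Exports.
Local Open Scope classical_set_scope.
Local Open Scope ring_scope.

Variant scalar_kind := RealScalars | ComplexScalars.

Definition scalars (R : realType) (c : scalar_kind) : numFieldType :=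
  match c with RealScalars => R | ComplexScalars => R[i] end.

Definition scalar_conj (R : realType) (c : scalar_kind) :
    scalars R c -> scalars R c :=
  match c with RealScalars => idfun | ComplexScalars => @Num.conj R[i] end.
Arguments scalar_conj R c : clear implicits.

(* As in the library's [Dot] structure, the inner product is linear in its
   first argument and conjugate-linear in the second. *)
Record hilbertSpace (R : realType) (c : scalar_kind) := HilbertSpace {
  hilbert_sort :> completeNormedModType (scalars R c) ;
  inner : {dot hilbert_sort for scalar_conj R c} ;
  inner_norm : forall x : hilbert_sort, inner x x = `|x| ^+ 2 }.

Notation "'⟨' x , y '⟩'" := (inner _ x y)
  (at level 0, x at level 99, y at level 99, format "'⟨' x ,  y '⟩'")
  : ring_scope.

(* A linear map defined on a linear subspace [dom]; the values of the
   underlying function outside [dom] are irrelevant. *)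
Record operator (F : numFieldType) (U V : lmodType F) := Operator {
  op_fun :> U -> V ;
  dom : set U ;
  dom_0 : dom 0 ;
  dom_linear : forall (a : F) x y, dom x -> dom y -> dom (a *: x + y) ;
  op_linear : forall (a : F) x y, dom x -> dom y ->
    op_fun (a *: x + y) = a *: op_fun x + op_fun y }.

Section Product.
Context {F : numFieldType} {U V W : lmodType F}.
Variables (S : operator V W) (A : operator U V).

Let pdom : set U := [set x | dom A x /\ dom S (A x)].

Lemma op_0 : A 0 = 0.
Proof.
have := op_linear (-1) (dom_0 A) (dom_0 A).
by rewrite scaler0 addr0 scaleN1r addNr.
Qed.

Fact product_dom_0 : pdom 0.
Proof. by split; [exact: dom_0 | rewrite op_0; exact: dom_0]. Qed.

Fact product_dom_linear (a : F) x y : pdom x -> pdom y -> pdom (a *: x + y).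
Proof.
move=> [xA xS] [yA yS]; split; first exact: dom_linear.
by rewrite op_linear//; exact: dom_linear.
Qed.

Fact product_linear (a : F) x y : pdom x -> pdom y ->
  S (A (a *: x + y)) = a *: S (A x) + S (A y).
Proof. by move=> [xA xS] [yA yS]; rewrite !op_linear. Qed.

Definition op_product : operator U W :=
  Operator product_dom_0 product_dom_linear product_linear.

End Product.

Definition extends {F : numFieldType} {U V : lmodType F} (T B : operator U V) :=
  dom B `<=` dom T /\ forall x, dom B x -> T x = B x.

Section HilbertOperators.
Context {R : realType} {c : scalar_kind} {H : hilbertSpace R c}.
Implicit Type S : operator H H.

Definition symmetric_op S :=
  forall f g, dom S f -> dom S g -> ⟨S f, g⟩ = ⟨f, S g⟩.

(* Over [R[i]], [0 <= z] says that [z] is real and nonnegative. *)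
Definition positive_op S :=
  symmetric_op S /\ forall f, dom S f -> 0 <= ⟨S f, f⟩.

(* The graph of the adjoint: [g] is in dom S^* and [S^* g = g'].  It is
   the graph of a function when [S] is densely defined. *)
Definition adjoint_graph S (g g' : H) :=
  forall f, dom S f -> ⟨S f, g⟩ = ⟨f, g'⟩.

Definition selfadjoint_op S :=
  dense (dom S) /\
  forall g g' : H, adjoint_graph S g g' <-> dom S g /\ S g = g'.

End HilbertOperators.

(* Main.v *)
(* Idea.  Condition (iii) says that the linear map [h] |-> B h, from the
   pre-Hilbert space (dom B, <B h, A k>) to H, is closable; writing T for its
   closure, S := T T^* is positive and self-adjoint, and S A h = B h because
   T^* (A h) is the class of h.  The completion is avoided by representing its
   elements by Cauchy sequences in dom B.  Everything rests on one minimisation,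
   of h |-> |B h - f|^2 + <B h, A h>: a minimising sequence gives x with
   x + S x = f, which together with symmetry yields self-adjointness, and (with
   the zero form and an inclusion in place of B) the orthogonal projection that
   turns a trivial orthogonal complement into density.  Since dom S is contained
   in the set of (ii), this also proves that (iii) implies (ii). *)
From HB Require Import structures.
Require Import Defs.
From mathcomp Require Import all_boot all_order all_algebra sesquilinear.
From mathcomp Require Import complex.
From mathcomp Require Import boolp classical_sets reals topology normedtype.
From mathcomp Require Import ring.
Import Order.TTheory GRing.Theory Num.Theory.
Import numFieldNormedType.Exports.
Local Open Scope classical_set_scope.
Local Open Scope ring_scope.
Set Implicit Arguments.
Unset Strict Implicit.
Unset Printing Implicit Defensive.

(** * Conjugation, infima and the Archimedean property, for real and complex scalars alike *)

Section Scalars.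
Context {R : realType} {c : scalar_kind}.
Local Notation F := (scalars R c).
Local Notation conj := (scalar_conj R c).
Implicit Types (x y e : F).

Fact scalar_conj_zmod_morphism : zmod_morphism conj.
Proof. by case: c => x y //=; rewrite rmorphB. Qed.

Fact scalar_conj_monoid_morphism : monoid_morphism conj.
Proof. by case: c; split => [|x y] //=; rewrite (rmorph1, rmorphM). Qed.

HB.instance Definition _ :=
  GRing.isZmodMorphism.Build F F conj scalar_conj_zmod_morphism.
HB.instance Definition _ :=
  GRing.isMonoidMorphism.Build F F conj scalar_conj_monoid_morphism.

Lemma mulr_scalar_conj x : x * conj x = `|x| ^+ 2.
Proof.
by case: c x => x /=; [rewrite real_normK ?num_real// expr2 | rewrite normCK].
Qed.

Lemma norm_scalar_conj x : `|conj x| = `|x|.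
Proof. by case: c x => x //=; rewrite norm_conjC. Qed.

Lemma ger0_scalar_conj x : 0 <= x -> conj x = x.
Proof. by case: c x => x //= x0; rewrite geC0_conj. Qed.

(** Over the complex numbers, [y = 1] and [y = 'i] make both [x] and ['i * x] real. *)
Lemma scalar_conj_fixed_mul x :
  (forall y, conj (y * x) = y * x) -> c = RealScalars \/ x = 0.
Proof.
case: c x => x xE; [by left | right].
have x1 := xE 1; have xi := xE 'i; rewrite !mul1r /= in x1.
move: xi; rewrite /= rmorphM /= conjCi x1 mulNr => /eqP.
by rewrite eq_sym -addr_eq0 -mulr2n mulrn_eq0 /= mulf_eq0
  (negbTE (neq0Ci _)) => /eqP.
Qed.

(** The order of [R[i]] is only partial, but its nonnegative elements are real, so the infimum is
    taken over real parts. *)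
Lemma scalar_inf (P : set F) : P !=set0 -> (forall x, P x -> 0 <= x) ->
  exists m, (forall x, P x -> m <= x) /\
            (forall e, 0 < e -> exists2 x, P x & x < m + e).
Proof.
case: c P => P [x0 Px0] P0 /=.
- have hP : has_inf P by split; [exists x0 | exists 0 => x /P0].
  exists (inf P); split=> [x Px|e e0]; first exact: (ge_inf hP.2).
  by have [x Px xe] := inf_adherent e0 hP; exists x.
- have PE z : P z -> z = (complex.Re z)%:C%C.
    by move=> /P0 /ger0_Im; case: z => a b /= ->.
  pose Q := [set complex.Re z | z in P].
  have hQ : has_inf Q.
    split; first by exists (complex.Re x0), x0.
    by exists 0 => _ [z /P0 + <-]; rewrite lecE => /andP[].
  exists (inf Q)%:C%C; split=> [z Pz|e].
    by rewrite (PE z Pz) lecR; apply: (ge_inf hQ.2); exists z.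
  case: e => a b; rewrite ltcE /= => /andP[/eqP -> a0].
  have [_ [z Pz <-] zlt] := inf_adherent a0 hQ.
  by exists z => //; rewrite (PE z Pz) ltcE /= addr0 eqxx.
Qed.

Lemma scalar_archi e : 0 < e -> exists n : nat, n.+1%:R^-1 < e.
Proof.
have archi (r : R) : 0 < r -> exists n : nat, n.+1%:R^-1 < r.
  move=> r0; exists (Num.truncn r^-1).
  by rewrite invf_plt ?posrE// truncnS_gt.
case: c e => e /=; first exact: archi.
case: e => a b; rewrite ltcE /= => /andP[/eqP -> /archi[n na]].
by exists n; rewrite -(@ltcR R) (fmorphV (real_complex R)) rmorph_nat in na.
Qed.

End Scalars.

(** * Convergence of sequences in epsilon form *)

Section Sequences.
Context {F : numFieldType}.

Lemma cvg_natP (V : normedModType F) (u : nat -> V) l :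
  u @ \oo --> l <->
  forall e : F, 0 < e -> exists N, forall n, (N <= n)%N -> `|u n - l| < e.
Proof.
split=> [/cvgrPdistC_lt ul e e0|ul]; first by have [N _ HN] := ul e e0; exists N.
by apply/cvgrPdistC_lt => e /ul[N HN]; exists N.
Qed.

Lemma cvg_nat0P (V : normedModType F) (u : nat -> V) :
  u @ \oo --> (0 : V) <->
  forall e : F, 0 < e -> exists N, forall n, (N <= n)%N -> `|u n| < e.
Proof.
by rewrite cvg_natP; split=> u0 e /u0[N HN]; exists N => n /HN; rewrite subr0.
Qed.

Lemma cauchy_nat_cvg (V : completeNormedModType F) (u : nat -> V) :
  (forall e : F, 0 < e -> exists N, forall m n, (N <= m)%N -> (N <= n)%N ->
     `|u m - u n| < e) ->
  exists l : V, u @ \oo --> l.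
Proof.
move=> uC; exists (lim (u @ \oo)); apply/cauchy_cvgP/cauchy_exP => e e0.
have [N HN] := uC e e0; exists (u N); exists N => // n /= Nn.
by rewrite -ball_normE /=; apply: HN.
Qed.

Lemma ltr_sqr_nneg (x y : F) : 0 <= x -> 0 < y -> x ^+ 2 < y ^+ 2 -> x < y.
Proof. by move=> x0 y0; rewrite ltr_pXn2r // nnegrE ltW. Qed.

(** Since [y <= y ^+ 2] for [1 <= y], bounds on squares can be used without square roots. *)
Lemma ler_of_sqr (x y : F) : 0 <= x -> 1 <= y -> x ^+ 2 <= y -> x <= y.
Proof.
move=> x0 y1 xy; have y0 := le_trans ler01 y1.
by rewrite -(@ler_pXn2r _ 2)// (le_trans xy)// expr2 ler_peMr.
Qed.

Lemma cvg0_sqr_le (V : normedModType F) (u : nat -> V) (w : nat -> F) (M : F) :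
  0 <= M -> (forall n, `|u n| ^+ 2 <= `|w n| * M) -> w @ \oo --> (0 : F) ->
  u @ \oo --> (0 : V).
Proof.
move=> M0 uw /cvg_nat0P w0; apply/cvg_nat0P => e e0.
have M1 : 0 < M + 1 by rewrite ltr_wpDl.
have [N HN] := w0 (e ^+ 2 / (M + 1)) (divr_gt0 (exprn_gt0 _ e0) M1).
exists N => n /HN; rewrite ltr_pdivlMr// => we.
apply: ltr_sqr_nneg => //; apply: le_lt_trans we.
by rewrite (le_trans (uw n))// ler_wpM2l// lerDl.
Qed.

End Sequences.

(** * Positive forms, Cauchy-Schwarz estimates and limits of inner products *)

Section PositiveForms.
Context {R : realType} {c : scalar_kind}.
Local Notation F := (scalars R c).
Local Notation conj := (scalar_conj R c).

Record pos_form (V : lmodType F) (b : V -> V -> F) : Prop := PosForm {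
  form_linear : forall (a : F) u v w, b (a *: u + v) w = a * b u w + b v w ;
  form_sym : forall u v, b u v = conj (b v u) ;
  form_ge0 : forall u, 0 <= b u u }.

Section Theory.
Variables (V : lmodType F) (b : V -> V -> F).
Hypothesis bP : pos_form b.
Implicit Types (u v w : V) (a m e : F).

Lemma formDl u v w : b (u + v) w = b u w + b v w.
Proof. by have := form_linear bP 1 u v w; rewrite scale1r mul1r. Qed.

Lemma form0l w : b 0 w = 0.
Proof. by apply: (addrI (b 0 w)); rewrite -formDl !addr0. Qed.

Lemma formZl a u w : b (a *: u) w = a * b u w.
Proof. by have := form_linear bP a u 0 w; rewrite !addr0 form0l addr0. Qed.

Lemma formNl u w : b (- u) w = - b u w.
Proof. by rewrite -scaleN1r formZl mulN1r. Qed.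

Lemma formBl u v w : b (u - v) w = b u w - b v w.
Proof. by rewrite formDl formNl. Qed.

Lemma formDr u v w : b w (u + v) = b w u + b w v.
Proof. by rewrite (form_sym bP) formDl rmorphD /= -!(form_sym bP). Qed.

Lemma formZr a u w : b w (a *: u) = conj a * b w u.
Proof. by rewrite (form_sym bP) formZl rmorphM /= -(form_sym bP). Qed.

Lemma formNr u w : b w (- u) = - b w u.
Proof. by rewrite (form_sym bP) formNl rmorphN /= -(form_sym bP). Qed.

Lemma formBr u v w : b w (u - v) = b w u - b w v.
Proof. by rewrite formDr formNr. Qed.

Lemma norm_form_sym u v : `|b u v| = `|b v u|.
Proof. by rewrite (form_sym bP) norm_scalar_conj. Qed.

Lemma form_parallelogram u v :
  b (u + v) (u + v) + b (u - v) (u - v) = 2 * b u u + 2 * b v v.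
Proof. by rewrite formBl !formBr !formDl !formDr; ring. Qed.

Lemma formD_le u v : b (u + v) (u + v) <= 2 * b u u + 2 * b v v.
Proof. by rewrite -form_parallelogram lerDl form_ge0. Qed.

(* The first-order condition at a vector [v] that minimises [b v v] on the line
   [v + s w] up to [e]; for [m = 0] it is a Cauchy-Schwarz inequality. *)
Lemma form_near_min v w m e :
  (forall s, m <= b (v + s *: w) (v + s *: w)) -> b v v <= m + e ->
  `|b v w| ^+ 2 <= e * (b w w + 1).
Proof.
move=> minv ve; set g := `|b v w| ^+ 2.
have p1 : 0 < b w w + 1 by rewrite ltr_wpDl ?form_ge0.
set d := (b w w + 1)^-1; have d0 : 0 < d by rewrite invr_gt0.
have g0 : 0 <= g by rewrite exprn_ge0.
have dE : conj d = d by rewrite ger0_scalar_conj// ltW.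
have gE : b v w * b w v = g by rewrite (form_sym bP w v) mulr_scalar_conj.
(* The exact minimiser on the line is [s = - b v w / b w w]; adding 1 to the denominator covers
   [b w w = 0] and still lowers the value by at least [d * g]. *)
have := minv (- (d * b v w)).
rewrite formDl !formDr !formZl !formZr rmorphN rmorphM/= -(form_sym bP) dE.
have -> : b v v + - (d * b w v) * b v w +
    (- (d * b v w) * b w v + - (d * b v w) * (- (d * b w v) * b w w)) =
    b v v - 2 * d * g + d * g * (d * b w w) by rewrite -gE; ring.
move=> h; have {}h := le_trans h (lerD (lerD ve (lexx _)) (lexx _)).
have dp : d * b w w <= 1 by rewrite mulrC ler_pdivrMr// mul1r lerDl.
have {}h := le_trans h (lerD (lexx _) (ler_wpM2l (mulr_ge0 (ltW d0) g0) dp)).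
move: h; have -> : m + e - 2 * d * g + d * g * 1 = m + (e - g * d) by ring.
by rewrite lerDl subr_ge0 ler_pdivrMr.
Qed.

Lemma form_CS v w : `|b v w| ^+ 2 <= b v v * (b w w + 1).
Proof.
by apply: (@form_near_min v w 0); [move=> s; exact: form_ge0 | rewrite add0r].
Qed.

Lemma form_CSr v w : `|b v w| ^+ 2 <= b w w * (b v v + 1).
Proof. by rewrite norm_form_sym form_CS. Qed.

End Theory.

Lemma inner_pos_form (H : hilbertSpace R c) : pos_form (fun x y : H => ⟨x, y⟩).
Proof.
split=> [a u v w|u v|u]; first exact: linearPl.
  by rewrite hermitian_subproof mul1r.
by rewrite inner_norm exprn_ge0.
Qed.

Lemma inner_cvg (H : hilbertSpace R c) (u : nat -> H) (x y : H) :
  u @ \oo --> x -> (fun n => ⟨u n, y⟩) @ \oo --> (⟨x, y⟩ : F).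
Proof.
move=> ux; apply: cvg_zero.
apply: (@cvg0_sqr_le _ _ _ (fun n => `|u n - x| ^+ 2) (⟨y, y⟩ + 1)).
- by rewrite addr_ge0 ?(form_ge0 (inner_pos_form H)).
- move=> n; rewrite /= -[_ n]/(⟨u n, y⟩ - ⟨x, y⟩) -(formBl (inner_pos_form H)).
  by rewrite -inner_norm (ger0_norm (form_ge0 (inner_pos_form H) _))
    (form_CS (inner_pos_form H)).
- have un0 : (fun n => `|u n - x|) @ \oo --> (0 : F).
    apply/cvg_nat0P => e; move/cvg_natP: ux => /[apply] -[N HN].
    by exists N => n /HN; rewrite normr_id.
  by rewrite -(mulr0 0); apply: cvgM.
Qed.

Lemma cvg_scalar_conj (u : nat -> F) (l : F) :
  u @ \oo --> l -> (fun n => conj (u n)) @ \oo --> (conj l : F).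
Proof.
move=> /cvg_natP ul; apply/cvg_natP => e /ul[N HN].
by exists N => n /HN; rewrite -rmorphB norm_scalar_conj.
Qed.

Lemma cvg_ge0 (u : nat -> F) (l : F) :
  (forall n, 0 <= u n) -> u @ \oo --> l -> 0 <= l.
Proof.
(* [u n] is its own norm, so [u] converges both to [l] and to the norm of [l]. *)
move=> u0 ul; suff -> : l = `|l| by [].
apply: (@cvg_unique F^o (@norm_hausdorff _ F^o) (u @ \oo)) => //.
have := cvg_norm ul; under eq_fun do rewrite ger0_norm//; exact.
Qed.

End PositiveForms.

(** * The graph of T T^* by way of Cauchy sequences *)

Section FormOperator.
Context {R : realType} {c : scalar_kind} {H : hilbertSpace R c}.
Local Notation F := (scalars R c).
Variables (E : lmodType F) (B : {linear E -> H}) (b : E -> E -> F).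
Hypothesis bP : pos_form b.
Let iP := inner_pos_form H.
Implicit Types (x y f : H) (h : nat -> E) (k : E).

Definition form_cauchy (h : nat -> E) := forall e : F, 0 < e ->
  exists N, forall m n, (N <= m)%N -> (N <= n)%N ->
    b (h m - h n) (h m - h n) < e.

(* [y = T T^* x], where [T] is the closure of [B] seen as an operator from the
   completion of [(E, b)] to [H]; the sequence [h] represents [T^* x]. *)
Definition form_graph (x y : H) := exists h : nat -> E,
  [/\ form_cauchy h, (fun n => B (h n)) @ \oo --> y &
    forall k, (fun n => b k (h n)) @ \oo --> (⟨B k, x⟩ : F)].

Lemma harmonic_le m n : (m <= n)%N -> n.+1%:R^-1 <= m.+1%:R^-1 :> F.
Proof. by move=> mn; rewrite lef_pV2 ?posrE ?ltr0n// ler_nat. Qed.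

Lemma harmonic_cvg0 : (fun n => n.+1%:R^-1) @ \oo --> (0 : F).
Proof.
apply/cvg_nat0P => e /scalar_archi[N Ne]; exists N => n Nn.
by rewrite ger0_norm ?invr_ge0//; apply: le_lt_trans (harmonic_le Nn) Ne.
Qed.

(** The parallelogram law makes a minimising sequence Cauchy for [b] and its image under [B] Cauchy
    in [H]; the first-order condition then identifies [f - x] with the limit of that image. *)
Lemma form_graph_surj (f : H) : exists x, form_graph x (f - x).
Proof.
(* The functional to minimise is the square of this form on the affine slice of pairs [(k, f)]. *)
pose g (p q : E * H) : F := ⟨B p.1 - p.2, B q.1 - q.2⟩ + b p.1 q.1.
have gP : pos_form g.
  split=> [a u v w|u v|u].
  - rewrite /g /= linearP opprD addrACA -scalerBr.
    by rewrite (form_linear iP) (form_linear bP) mulrDr; ring.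
  - by rewrite /g rmorphD /= -(form_sym iP) -(form_sym bP).
  - by rewrite addr_ge0// ?(form_ge0 iP) ?(form_ge0 bP).
have [m [min_m inf_m]] := @scalar_inf R c (range (fun k => g (k, f) (k, f)))
  (ex_intro _ _ (imageT _ 0)) ltac:(by move=> _ [k _ <-]; exact: form_ge0).
have {}min_m k : m <= g (k, f) (k, f) by apply: min_m; exists k.
have /choice[h hm] n : exists k, g (k, f) (k, f) < m + n.+1%:R^-1.
  by have [|_ [k _ <-] ?] := inf_m n.+1%:R^-1; [rewrite invr_gt0 | exists k].
have close n (k : nat) : `|B (h n) - B (h k)| ^+ 2 + b (h n - h k) (h n - h k) <=
    2 * (n.+1%:R^-1 + k.+1%:R^-1).
  have -> : `|B (h n) - B (h k)| ^+ 2 + b (h n - h k) (h n - h k) =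
      g ((h n, f) - (h k, f)) ((h n, f) - (h k, f)).
    by rewrite /g /= subrr subr0 linearB inner_norm.
  have := form_parallelogram gP (h n, f) (h k, f).
  (* The midpoint lies in the same slice, so its value is at least [m], while both end points are
     nearly minimal. *)
  have -> : (h n, f) + (h k, f) = 2 *: (2^-1 *: (h n + h k), f) :> E * H.
    by congr pair => /=; rewrite ?scalerA ?divff ?scale1r ?pnatr_eq0// scaler_nat.
  rewrite (formZl gP) (formZr gP) ger0_scalar_conj//.
  move=> /(canRL (addKr _)) ->; rewrite addrC lerBlDr.
  have -> : 2 * (n.+1%:R^-1 + k.+1%:R^-1) + 2 * (2 *
       g (2^-1 *: (h n + h k), f) (2^-1 *: (h n + h k), f)) =
     2 * (g (2^-1 *: (h n + h k), f) (2^-1 *: (h n + h k), f) + n.+1%:R^-1) +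
     2 * (g (2^-1 *: (h n + h k), f) (2^-1 *: (h n + h k), f) + k.+1%:R^-1).
    by ring.
  by apply: lerD; rewrite ler_pM2l//; apply: (le_trans (ltW (hm _)));
    rewrite lerD2r.
have {}close (e : F) : 0 < e -> exists N, forall n k : nat,
    (N <= n)%N -> (N <= k)%N ->
    `|B (h n) - B (h k)| ^+ 2 + b (h n - h k) (h n - h k) < e.
  move=> e0; have [N Ne] := scalar_archi (divr_gt0 e0 (ltr0n _ 4)).
  exists N => n k Nn Nk; apply: (le_lt_trans (close n k)).
  apply: (@le_lt_trans _ _ (2 * (N.+1%:R^-1 + N.+1%:R^-1))).
    by rewrite ler_pM2l// lerD// harmonic_le.
  by rewrite (_ : _ * _ = N.+1%:R^-1 * 4); [rewrite -ltr_pdivlMr | ring].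
have [u Bu] : exists u : H, (fun n => B (h n)) @ \oo --> u.
  apply: cauchy_nat_cvg => e e0; have [N HN] := close _ (exprn_gt0 2 e0).
  exists N => n k Nn Nk; apply: ltr_sqr_nneg => //.
  by apply: le_lt_trans (HN n k Nn Nk); rewrite lerDl form_ge0.
exists (f - u), h; split; last 1 first.
- move=> k; rewrite (form_sym iP); under eq_fun do rewrite (form_sym bP).
  apply: cvg_scalar_conj; rewrite (formBl iP).
  (* The direction [(k, 0)] keeps [f] fixed, so near-minimality forces [g (h n, f) (k, 0)] to tend
     to 0. *)
  have -> : (fun n => b (h n) k) =
      (fun n => g (h n, f) (k, 0) + (⟨f, B k⟩ - ⟨B (h n), B k⟩)).
    by apply/funext => n; rewrite /g /= subr0 (formBl iP); ring.
  rewrite -[X in _ --> X]add0r; apply: cvgD.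
    apply: (@cvg0_sqr_le _ _ _ (fun n => n.+1%:R^-1) (g (k, 0) (k, 0) + 1)).
    + by rewrite addr_ge0 ?(form_ge0 gP).
    + move=> n; rewrite [`|_^-1|]ger0_norm ?invr_ge0//.
      apply: (@form_near_min _ _ _ _ gP _ _ m); last exact/ltW/hm.
      by move=> s; rewrite /= -[_ + _]/(h n + s *: k, f + s *: 0) scaler0 addr0.
    + exact: harmonic_cvg0.
  by apply: cvgB; [exact: cvg_cst | exact: inner_cvg].
- move=> e /close[N HN]; exists N => n k Nn Nk.
  by apply: le_lt_trans (HN n k Nn Nk); rewrite lerDr exprn_ge0.
- by rewrite opprB addrC subrK.
Qed.


Lemma form_cauchy_bounded h : form_cauchy h ->
  exists N (M : F), 0 <= M /\ forall n, (N <= n)%N -> b (h n) (h n) <= M.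
Proof.
move=> /(_ 1 ltr01)[N HN]; exists N, (2 * 1 + 2 * b (h N) (h N)); split=> [|n Nn].
  by rewrite addr_ge0 ?mulr_ge0 ?(form_ge0 bP).
rewrite -[h n](subrK (h N)) (le_trans (formD_le bP _ _))// lerD2r ler_pM2l//.
exact/ltW/HN.
Qed.

(** The convergence to [l] is only pointwise. For each [n], an index [m] depending on [n] brings
    [b (h n) (h' m)] close to [l (h n)]; passing from [h' m] to [h' n] costs little uniformly, as
    [h] is eventually bounded and [h'] is Cauchy. *)
Lemma form_cauchy_lim h h' (l : E -> F) : form_cauchy h -> form_cauchy h' ->
  (forall k, (fun n => b k (h' n)) @ \oo --> l k) ->
  (fun n => l (h n) - b (h n) (h' n)) @ \oo --> (0 : F).
Proof.
move=> /form_cauchy_bounded[N1 [M [M0 hM]]] h'C h'l; apply/cvg_nat0P => e e0.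
have M1 : 0 < M + 1 by rewrite ltr_wpDl.
have e2 : 0 < e / 2 by rewrite divr_gt0.
have [N2 HN] := h'C _ (divr_gt0 (exprn_gt0 2 e2) M1).
exists (maxn N1 N2) => n; rewrite geq_max => /andP[N1n N2n].
move/cvg_natP: (h'l (h n)) => /(_ _ e2)[N3 lN].
have := lN _ (leq_maxl N3 N2); set m := maxn N3 N2; rewrite distrC => lm.
have bm : `|b (h n) (h' m - h' n)| < e / 2.
  apply: ltr_sqr_nneg => //; apply: (le_lt_trans (form_CSr bP _ _)).
  apply: (@le_lt_trans _ _ (b (h' m - h' n) (h' m - h' n) * (M + 1))).
    by rewrite ler_wpM2l ?(form_ge0 bP)// lerD2r hM.
  by rewrite -ltr_pdivlMr// HN// leq_maxr.
have -> : l (h n) - b (h n) (h' n) =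
    (l (h n) - b (h n) (h' m)) + b (h n) (h' m - h' n).
  by rewrite (formBr bP) addrA subrK.
by apply: (le_lt_trans (ler_normD _ _)); rewrite [e]splitr ltrD.
Qed.

(** This is the adjoint relation between T and T^*, tested on the classes of [h] and [h']; symmetry
    and positivity of the graph follow from it. *)
Lemma form_graph_cvg h y h' x' :
  form_cauchy h -> (fun n => B (h n)) @ \oo --> y ->
  form_cauchy h' -> (forall k, (fun n => b k (h' n)) @ \oo --> (⟨B k, x'⟩ : F)) ->
  (fun n => b (h n) (h' n)) @ \oo --> (⟨y, x'⟩ : F).
Proof.
move=> hC hy h'C h'x.
have -> : (fun n => b (h n) (h' n)) =
    (fun n => ⟨B (h n), x'⟩ - (⟨B (h n), x'⟩ - b (h n) (h' n))).
  by apply/funext => n; rewrite subKr.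
rewrite -[X in _ --> X]subr0.
exact: cvgB (inner_cvg hy) (form_cauchy_lim hC h'C h'x).
Qed.

Lemma form_graph_sym x y x' y' :
  form_graph x y -> form_graph x' y' -> ⟨y, x'⟩ = ⟨x, y'⟩.
Proof.
move=> [h [hC hy hx]] [h' [h'C h'y h'x]].
have := cvg_scalar_conj (form_graph_cvg h'C h'y hC hx).
under eq_fun do rewrite -(form_sym bP); rewrite -(form_sym iP).
exact: cvg_unique (form_graph_cvg hC hy h'C h'x).
Qed.

Lemma form_graph_ge0 x y : form_graph x y -> 0 <= ⟨y, x⟩.
Proof.
move=> [h [hC hy hx]]; apply: cvg_ge0 _ (form_graph_cvg hC hy hC hx).
by move=> n; exact: form_ge0.
Qed.

Lemma form_graph_linear a x y x' y' :
  form_graph x y -> form_graph x' y' -> form_graph (a *: x + x') (a *: y + y').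
Proof.
move=> [h [hC hy hx]] [h' [h'C h'y h'x]]; exists (fun n => a *: h n + h' n).
split.
- move=> e e0; have a1 : 0 < `|a| ^+ 2 + 1 by rewrite ltr_wpDl ?exprn_ge0.
  have e4 : 0 < e / 4 by rewrite divr_gt0.
  have [N HN] := hC _ (divr_gt0 e4 a1).
  have [N' HN'] := h'C _ e4.
  exists (maxn N N') => m n; rewrite !geq_max => /andP[Nm N'm] /andP[Nn N'n].
  rewrite opprD addrACA -scalerBr (le_lt_trans (formD_le bP _ _))//.
  rewrite (formZl bP) (formZr bP) [a * _]mulrA mulr_scalar_conj.
  have -> : e = 2 * (e / 4) + 2 * (e / 4) by field.
  rewrite ltrD// ltr_pM2l// ?HN'//.
  apply: (@le_lt_trans _ _ (b (h m - h n) (h m - h n) * (`|a| ^+ 2 + 1))).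
    by rewrite mulrC ler_wpM2l ?(form_ge0 bP)// lerDl.
  by rewrite -ltr_pdivlMr// HN.
- under eq_fun do rewrite linearP.
  by apply: cvgD => //; exact: cvgZl_tmp.
- move=> k; rewrite (formDr iP) (formZr iP).
  under eq_fun do rewrite (formDr bP) (formZr bP).
  by apply: cvgD => //; exact: cvgMl_tmp.
Qed.

Lemma form_graph0 : form_graph 0 0.
Proof.
exists (fun=> 0); split=> [e e0|//|k].
- by exists 0%N => m n _ _; rewrite subr0 (form0l bP).
- by rewrite linear0; exact: cvg_cst.
- by rewrite (form_sym iP) (form0l iP) (form_sym bP) (form0l bP); exact: cvg_cst.
Qed.

(** Here T^* x is the class of [k] itself, represented by a constant sequence; the intended [x] is
    the image of [k] under [A]. *)
Lemma form_graph_id k x : (forall k', ⟨B k', x⟩ = b k' k) -> form_graph x (B k).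
Proof.
move=> kx; exists (fun=> k); split=> [e e0||k']; last 2 first.
- exact: cvg_cst.
- by rewrite kx; exact: cvg_cst.
by exists 0%N => m n _ _; rewrite subrr (form0l bP).
Qed.

(** The functional [k] |-> [⟨B k, x⟩] is the pairing with T^* x, hence bounded on the unit ball of
    [b]. This places the domain of S in the set of (ii). *)
Lemma form_graph_bounded x y : form_graph x y ->
  exists M : F, forall k, b k k <= 1 -> `|⟨B k, x⟩| <= M.
Proof.
move=> [h [hC _ hx]]; have [N [M [M0 hM]]] := form_cauchy_bounded hC.
(* The last 1 pays for replacing [⟨B k, x⟩] by [b k (h n)], whose square is at most [M * 2]; the
   other 1 puts the bound above 1, as [ler_of_sqr] requires. *)
exists (2 * M + 1 + 1) => k k1.
move/cvg_natP: (hx k) => /(_ _ ltr01)[N' hN'].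
have := hN' _ (leq_maxl N' N); set n := maxn N' N; rewrite distrC => kn.
rewrite -[⟨B k, x⟩](subrK (b k (h n))) (le_trans (ler_normD _ _))//.
rewrite addrC lerD//; last exact: ltW.
apply: ler_of_sqr; rewrite ?lerDr ?mulr_ge0//.
apply: le_trans (form_CSr bP _ _) _; apply: (@le_trans _ _ (M * 2)).
  by rewrite ler_pM ?addr_ge0 ?(form_ge0 bP) ?lerD2r// hM// leq_maxr.
by rewrite mulrC lerDl.
Qed.

Hypothesis closable : forall (h : nat -> E) (f : H),
  (fun n => b (h n) (h n)) @ \oo --> (0 : F) ->
  (fun n => B (h n)) @ \oo --> f -> f = 0.

(** Subtracting the two graph points gives a Cauchy sequence that pairs to 0 with every vector in
    the limit; its form values then tend to 0, and closability applies. *)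
Lemma form_graph_fun x y y' : form_graph x y -> form_graph x y' -> y = y'.
Proof.
move=> xy xy'; apply/eqP; rewrite -subr_eq0; apply/eqP.
have := form_graph_linear (-1) xy' xy.
rewrite !scaleN1r addNr addrC => -[h [hC hy h0]]; apply: closable hy.
have {}h0 k : (fun n => b k (h n)) @ \oo --> (0 : F).
  by have := h0 k; rewrite (form_sym iP) (form0l iP) rmorph0.
have -> : (fun n => b (h n) (h n)) = (fun n => - (0 - b (h n) (h n))).
  by apply/funext => n; rewrite sub0r opprK.
by rewrite -[X in _ --> X]oppr0; exact: cvgN (form_cauchy_lim hC hC h0).
Qed.

End FormOperator.

(** * The domain of an operator as a vector space of its own *)

Section Domain.
Context {F : numFieldType} {U V : lmodType F}.
Variable T : operator U V.

Definition dom_pred : {pred U} := fun x => `[< dom T x >].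

Fact dom_submod_closed : submod_closed dom_pred.
Proof.
split=> [|a x y /asboolP xT /asboolP yT]; apply/asboolP; first exact: dom_0.
exact: dom_linear.
Qed.

HB.instance Definition _ := GRing.isSubmodClosed.Build F U dom_pred
  dom_submod_closed.

(** As a module, the domain can serve as the space [E] above, on which the operator becomes a total
    linear map. *)
Record dom_type := DomType { dom_val : U ; dom_valP : dom_val \in dom_pred }.

HB.instance Definition _ := [isSub for dom_val].
HB.instance Definition _ := [Choice of dom_type by <:].
HB.instance Definition _ := [SubChoice_isSubLmodule of dom_type by <:].

Lemma dom_dom_val (h : dom_type) : dom T (dom_val h).
Proof. exact/asboolP/dom_valP. Qed.

Lemma dom_type_of x : dom T x -> exists h : dom_type, dom_val h = x.
Proof. by move=> /asboolP xT; exists (DomType xT). Qed.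

Lemma dom_val_linear a (h k : dom_type) :
  dom_val (a *: h + k) = a *: dom_val h + dom_val k.
Proof. exact: (linearP (val : dom_type -> U)). Qed.

Definition dom_fun (h : dom_type) : V := T (dom_val h).

Fact dom_fun_linear : linear dom_fun.
Proof.
by move=> a h k; rewrite /dom_fun dom_val_linear op_linear//; exact: dom_dom_val.
Qed.

HB.instance Definition _ := GRing.isLinear.Build F dom_type V *:%R dom_fun
  dom_fun_linear.

End Domain.
Arguments dom_fun {F U V} T h.

(** * Density and orthogonal complements *)

Section Density.
Context {R : realType} {c : scalar_kind} {H : hilbertSpace R c}.
Local Notation F := (scalars R c).

Lemma dense_of_approx (D : set H) :
  (forall f : H, exists2 u : nat -> H, forall n, D (u n) & u @ \oo --> f) ->
  dense D.
Proof.
move=> Dlim O [f Of] Oo; have [u uD uf] := Dlim f.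
have [N _ HN] := uf _ (open_nbhs_nbhs (conj Oo Of)).
by exists (u N); split=> //; exact: (HN N (leqnn N)).
Qed.

Lemma dense_of_orth (D : set H) : D 0 ->
  (forall (a : F) x y, D x -> D y -> D (a *: x + y)) ->
  (forall w : H, (forall x, D x -> ⟨x, w⟩ = 0) -> w = 0) -> dense D.
Proof.
move=> D0 Dlin Dorth; apply: dense_of_approx => f.
pose I : operator H H := Operator D0 Dlin (fun a x y _ _ => erefl (a *: x + y)).
have bP : pos_form (fun _ _ : dom_type I => 0 : F).
  by split=> *; rewrite ?mulr0 ?addr0 ?rmorph0.
(* With the inclusion and the zero form, [f - x] is a limit of elements of [D] and [x] is orthogonal
   to [D]. *)
have [x [h [_ hf hx]]] := form_graph_surj (dom_fun I) bP f.
have x0 : x = 0.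
  apply: Dorth => k Dk; have [k' <-] := dom_type_of (T := I) Dk.
  exact: cvg_unique (hx k') (cvg_cst _).
exists (fun n => dom_val (h n)) => [n|]; first exact: (dom_dom_val (h n)).
by rewrite x0 subr0 in hf.
Qed.

Lemma dense_orth (D : set H) (f : H) : dense D ->
  (forall g, D g -> ⟨g, f⟩ = 0) -> f = 0.
Proof.
move=> Dd Df; have /choice[u uD] n : exists g, D g /\ `|f - g| < n.+1%:R^-1.
  have [|g []] := Dd (ball f n.+1%:R^-1) _ (ball_open f n.+1%:R^-1).
    by exists f; apply: ballxx; rewrite invr_gt0.
  by rewrite -ball_normE => fg Dg; exists g.
have uf : u @ \oo --> f.
  apply/cvg_natP => e /scalar_archi[N Ne]; exists N => n Nn; rewrite distrC.
  by rewrite (lt_trans (uD n).2)// (le_lt_trans (harmonic_le Nn)).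
have := inner_cvg (y := f) uf; under eq_fun do rewrite (Df _ (uD _).1).
move=> uf0; have : ⟨f, f⟩ = 0 by exact: cvg_unique uf0 (cvg_cst _).
by move/eqP; rewrite inner_norm sqrf_eq0 normr_eq0 => /eqP.
Qed.

End Density.

(** * Cauchy-Schwarz for a positive operator *)

Section PositiveOperator.
Context {R : realType} {c : scalar_kind} {H : hilbertSpace R c}.
Variable S : operator H H.
Hypothesis Spos : positive_op S.

Lemma positive_op_form :
  pos_form (fun u v : dom_type S => ⟨S (dom_val u), dom_val v⟩).
Proof.
have iP := inner_pos_form H.
split=> [a u v w|u v|u]; last exact/Spos.2/dom_dom_val.
- by rewrite op_linear ?(form_linear iP)//; exact: dom_dom_val.
- by rewrite Spos.1 ?(form_sym iP (dom_val u)); try exact: dom_dom_val.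
Qed.

Lemma positive_op_CS x y : dom S x -> dom S y ->
  `|⟨S x, y⟩| ^+ 2 <= ⟨S x, x⟩ * (⟨S y, y⟩ + 1).
Proof.
move=> /dom_type_of[u <-] /dom_type_of[v <-]; exact: form_CS positive_op_form u v.
Qed.

End PositiveOperator.

(** * The positive self-adjoint operator of a closable form *)

Section FormOperatorDensity.
Context {R : realType} {c : scalar_kind} {H : hilbertSpace R c}.
Local Notation F := (scalars R c).
Variables (E : lmodType F) (B : {linear E -> H}) (b : E -> E -> F).
Hypothesis bP : pos_form b.
Hypothesis closable : forall (h : nat -> E) (f : H),
  (fun n => b (h n) (h n)) @ \oo --> (0 : F) ->
  (fun n => B (h n)) @ \oo --> f -> f = 0.
Let iP := inner_pos_form H.

(** Let w be orthogonal to the domain and write w = x + S x. Then positivity of [⟨w - x, x⟩], which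
    is minus the squared norm of x, forces x = 0, and w = S 0 = 0. *)
Lemma form_graph_dense : dense [set x : H | exists y, form_graph B b x y].
Proof.
apply: dense_of_orth => [|a x x' [y xy] [y' xy']|w wD].
- by exists 0; exact: form_graph0.
- by exists (a *: y + y'); exact: form_graph_linear.
have [x xy] := form_graph_surj B bP w.
have := wD x (ex_intro _ _ xy) => xw.
have := form_graph_ge0 bP xy.
rewrite (formBl iP) (form_sym iP) xw rmorph0 sub0r oppr_ge0 inner_norm => xn.
have x0 : x = 0.
  apply/eqP; rewrite -normr_eq0 -sqrf_eq0 eq_le xn exprn_ge0//.
move: xy; rewrite x0 subr0; move/form_graph_fun; apply => //.
exact: form_graph0.
Qed.

Definition form_op_fun (x : H) : H := xget 0 [set y | form_graph B b x y].

Lemma form_op_funE x y : form_graph B b x y -> form_op_fun x = y.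
Proof.
by move=> xy; apply: xget_unique => // y' /(form_graph_fun bP closable); exact.
Qed.

Let D : set H := [set x | exists y, form_graph B b x y].

Fact form_op_dom_0 : D 0. Proof. by exists 0; exact: form_graph0. Qed.

Fact form_op_dom_linear (a : F) x x' : D x -> D x' -> D (a *: x + x').
Proof.
by move=> [y xy] [y' xy']; exists (a *: y + y'); exact: form_graph_linear.
Qed.

Fact form_op_linear (a : F) x x' : D x -> D x' ->
  form_op_fun (a *: x + x') = a *: form_op_fun x + form_op_fun x'.
Proof.
move=> [y xy] [y' xy']; rewrite (form_op_funE xy) (form_op_funE xy').
exact/form_op_funE/form_graph_linear.
Qed.

Definition form_op : operator H H :=
  Operator form_op_dom_0 form_op_dom_linear form_op_linear.

Lemma form_opP x y : form_graph B b x y <-> dom form_op x /\ form_op x = y.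
Proof.
split=> [xy|[[y' xy'] <-]]; first by split; [exists y | exact: form_op_funE].
by rewrite (_ : form_op x = y')//; exact: form_op_funE.
Qed.

Lemma form_op_graph x : dom form_op x -> form_graph B b x (form_op x).
Proof. by move=> xD; exact/form_opP. Qed.

Lemma form_op_positive : positive_op form_op.
Proof.
split=> [f g /form_op_graph fD /form_op_graph gD|f /form_op_graph].
  exact: form_graph_sym fD gD.
exact: form_graph_ge0.
Qed.

(* A symmetric operator [S] with [1 + S] onto is self-adjoint. *)
Lemma form_op_selfadjoint : selfadjoint_op form_op.
Proof.
split=> [|g g']; first exact: form_graph_dense.
split=> [gA|[/form_op_graph gD <-] f /form_op_graph fD]; last first.
  exact: form_graph_sym fD gD.
have [x xy] := form_graph_surj B bP (g + g').
suff gx : g = x by move: xy; rewrite -gx addrAC subrr add0r => /form_opP.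
have [f fy] := form_graph_surj B bP (g - x).
have [fD fS] := (form_opP _ _).1 fy.
have := gA f fD; rewrite fS => fg; have fx := form_graph_sym bP fy xy.
(* For [v = g - x] one has S f = [v - f], so the first bracket vanishes by the adjoint relation for
   [g] and the second by symmetry with [x]. *)
have E0 v : ⟨v, g - x⟩ = (⟨v - f, g⟩ - ⟨f, g'⟩) - (⟨v - f, x⟩ - ⟨f, g + g' - x⟩).
  by rewrite !(formBr iP) !(formBl iP) (formDr iP); ring.
apply/eqP; rewrite -subr_eq0 -normr_eq0 -sqrf_eq0 -inner_norm E0 fg fx.
by rewrite !subrr.
Qed.

End FormOperatorDensity.

(** * The form built from [A] and [B] *)

Section ProductForm.
Context {R : realType} {c : scalar_kind} {H K : hilbertSpace R c}.
Local Notation F := (scalars R c).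
Local Notation conj := (scalar_conj R c).
Variables A B : operator K H.
Hypothesis domBA : dom B `<=` dom A.
Hypothesis nonneg : forall h, dom B h -> 0 <= ⟨B h, A h⟩.
Let iP := inner_pos_form H.
Let B' : {linear dom_type B -> H} := dom_fun B.

(* Over the reals [⟨B h, A k⟩] need not be symmetric, hence the symmetrization. *)
Definition product_form (h k : dom_type B) : F :=
  2^-1 * (⟨B (dom_val h), A (dom_val k)⟩ + ⟨A (dom_val h), B (dom_val k)⟩).

Lemma product_formE h :
  product_form h h = ⟨B (dom_val h), A (dom_val h)⟩.
Proof.
rewrite /product_form [⟨A _, _⟩](form_sym iP) ger0_scalar_conj; last first.
  exact/nonneg/dom_dom_val.
by field.
Qed.

Lemma product_form_pos : pos_form product_form.
Proof.
split=> [a u v w|u v|u].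
- rewrite /product_form dom_val_linear !op_linear; try exact: dom_dom_val.
    by rewrite !(form_linear iP); ring.
  1,2: exact/domBA/dom_dom_val.
- rewrite /product_form rmorphM rmorphD /= -!(form_sym iP) addrC.
  by rewrite ger0_scalar_conj// invr_ge0.
- by rewrite product_formE; exact/nonneg/dom_dom_val.
Qed.

Lemma product_form_closable :
  (forall (h : nat -> K) (f : H), (forall n, dom B (h n)) ->
    (fun n => ⟨B (h n), A (h n)⟩) @ \oo --> (0 : F) ->
    (fun n => B (h n)) @ \oo --> f -> f = 0) ->
  forall (h : nat -> dom_type B) (f : H),
    (fun n => product_form (h n) (h n)) @ \oo --> (0 : F) ->
    (fun n => B' (h n)) @ \oo --> f -> f = 0.
Proof.
move=> clos h f h0 hf; apply: (clos (fun n => dom_val (h n)) f) => // [n|].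
  exact: dom_dom_val.
by under eq_fun do rewrite -product_formE.
Qed.

Lemma form_graph_has_ubound x y : form_graph B' product_form x y ->
  has_ubound [set `|⟨B h, x⟩| | h in [set h | dom B h /\ ⟨B h, A h⟩ <= 1]].
Proof.
move=> /(form_graph_bounded product_form_pos)[M HM]; exists M => _ [h [hB h1] <-].
have [k kh] := dom_type_of hB; rewrite -kh; apply: HM.
by rewrite product_formE kh.
Qed.

(** By homogeneity, a bound [M] where the quadratic form is at most 1 becomes [M * d] where it is at
    most [d ^+ 2]. *)
Lemma has_ubound_cvg0 (h : nat -> K) (g : H) : (forall n, dom B (h n)) ->
  (fun n => ⟨B (h n), A (h n)⟩) @ \oo --> (0 : F) ->
  has_ubound [set `|⟨B h, g⟩| | h in [set h | dom B h /\ ⟨B h, A h⟩ <= 1]] ->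
  (fun n => ⟨B (h n), g⟩) @ \oo --> (0 : F).
Proof.
move=> hB /cvg_nat0P qh [M HM]; apply/cvg_nat0P => e e0.
have {}HM k : dom B k -> ⟨B k, A k⟩ <= 1 -> `|⟨B k, g⟩| <= M.
  by move=> kB k1; apply: HM; exists k.
have opZ (T : operator K H) a k : dom T k -> T (a *: k) = a *: T k.
  by move=> kT; rewrite -[a *: k]addr0 op_linear ?op_0 ?addr0//; exact: dom_0.
have M0 : 0 <= M.
  apply: le_trans (HM 0 (dom_0 B) _) => //.
  by rewrite op_0 (form0l iP).
have M1 : 0 < M + 1 by rewrite ltr_wpDl.
(* This choice gives [M * d < e], also when [M = 0]. *)
set d := e / (M + 1); have d0 : 0 < d by rewrite divr_gt0.
have [N HN] := qh _ (exprn_gt0 2 d0); exists N => n /HN.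
rewrite ger0_norm ?nonneg// => qn.
have dB : dom B (d^-1 *: h n).
  by rewrite -[_ *: _]addr0; apply: dom_linear => //; exact: dom_0.
have dV : 0 <= d^-1 by rewrite invr_ge0 ltW.
have : `|⟨B (d^-1 *: h n), g⟩| <= M.
  apply: HM => //; rewrite !opZ//; last exact: domBA.
  rewrite (formZl iP) (formZr iP) ger0_scalar_conj// mulrA -expr2 exprVn mulrC.
  by rewrite ler_pdivrMr ?exprn_gt0// mul1r ltW.
rewrite opZ// (formZl iP) normrM (ger0_norm dV) mulrC ler_pdivrMr// => hM.
apply: le_lt_trans hM _.
by rewrite /d mulrCA gtr_pMr// ltr_pdivrMr// mul1r ltrDl.
Qed.

(** Polarisation: the quadratic form is real at [a *: h + k] for every [a], so every multiple of the
    difference of the two sides is fixed by conjugation. *)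
Lemma product_symmetric h k :
  (c = RealScalars -> forall h k, dom B h -> dom B k ->
    ⟨B h, A k⟩ = ⟨A h, B k⟩) ->
  dom B h -> dom B k -> ⟨B h, A k⟩ = ⟨A h, B k⟩.
Proof.
move=> real_sym hB kB.
have /scalar_conj_fixed_mul[/real_sym->//|/eqP] :
    forall a, conj (a * (⟨B h, A k⟩ - ⟨A h, B k⟩)) =
      a * (⟨B h, A k⟩ - ⟨A h, B k⟩).
  move=> a; have q0 x : dom B x -> ⟨B x, A x⟩ = ⟨A x, B x⟩.
    by move=> /nonneg q0; rewrite [RHS](form_sym iP) ger0_scalar_conj.
  have := q0 _ (dom_linear a hB kB).
  rewrite !op_linear; try by [|exact: domBA].
  rewrite !(formDl iP) !(formDr iP) !(formZl iP) !(formZr iP) (q0 h)// (q0 k)//.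
  rewrite rmorphM rmorphB /= -!(form_sym iP) => /eqP.
  rewrite -subr_eq0 => /eqP q1; apply/eqP; rewrite -subr_eq0 -oppr_eq0; apply/eqP.
  by rewrite -q1; ring.
by rewrite subr_eq0 => /eqP.
Qed.

End ProductForm.
Arguments product_form {R c H K} A B h k.

(** * The equivalences *)

Theorem corollary2p3 (R : realType) (c : scalar_kind) (H K : hilbertSpace R c)
    (A B : operator K H) (domBA : dom B `<=` dom A) :
  let cond_i := exists S : operator H H,
    [/\ positive_op S, selfadjoint_op S & extends (op_product S A) B] in
  let nonneg := forall h, dom B h -> 0 <= ⟨B h, A h⟩ in
  let cond_ii := nonneg /\
    dense [set g : H | has_ubound
      [set `|⟨B h, g⟩| | h in [set h | dom B h /\ ⟨B h, A h⟩ <= 1]]] in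
  let cond_iii := forall (h : nat -> K) (f : H),
    (forall n, dom B (h n)) ->
    (fun n => ⟨B (h n), A (h n)⟩) @ \oo --> (0 : scalars R c) ->
    (fun n => B (h n)) @ \oo --> f ->
    f = 0 in
  (* Over the reals positivity of the form (h, k) |-> <Bh, Ak> does not imply
     its symmetry; over the complex numbers it does. *)
  let real_sym := c = RealScalars ->
    forall h k, dom B h -> dom B k -> ⟨B h, A k⟩ = ⟨A h, B k⟩ in
  (cond_i <-> cond_ii /\ real_sym) /\ (cond_ii <-> nonneg /\ cond_iii).
Proof.
move=> cond_i nonneg cond_ii cond_iii real_sym.
have iP := inner_pos_form H.
(* The limit [f] is orthogonal to each [g] of the dense set, since [⟨B (h n), g⟩] tends both to 0
   and to [⟨f, g⟩]. *)
have clos : cond_ii -> cond_iii.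
  move=> [q0 dD] h f hB qh Bh; apply: (dense_orth dD) => g Dg.
  rewrite (form_sym iP) (_ : ⟨f, g⟩ = 0) ?rmorph0//.
  exact: cvg_unique (inner_cvg Bh) (has_ubound_cvg0 domBA q0 hB qh Dg).
have dense_ii : nonneg -> cond_iii -> cond_ii.
  move=> q0 clos3; split=> //.
  have bP := product_form_pos domBA q0.
  move=> O O0 /(form_graph_dense bP (product_form_closable q0 clos3) O0).
  move=> [x [Ox [y xy]]]; exists x; split=> //.
  exact: form_graph_has_ubound xy.
split; last by split=> [ii|[]//]; split; [exact: ii.1 | exact: clos].
split=> [[S [[Ssym Spos] [Sdense _] [SB SE]]]|[ii rs]].
  have SAh h : dom B h -> dom S (A h) /\ S (A h) = B h.
    by move=> hB; split; [case: (SB h hB) | exact: SE].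
  split; last first.
    move=> _ h k /SAh[hS <-] /SAh[kS <-]; exact: Ssym.
  split=> [h /SAh[hS <-]|O O0 /(Sdense O O0)[g [Og gS]]]; first exact: Spos.
  (* Cauchy-Schwarz for S at [A h] and [g] bounds the square of the pairing by this constant, which
     is at least 1 and so bounds the pairing itself. *)
  exists g; split=> //=; exists (⟨S g, g⟩ + 1) => _ [h [hB q1] <-].
  have [AhS SAhE] := SAh h hB; rewrite -SAhE in q1 *.
  apply: ler_of_sqr; rewrite ?lerDr ?Spos//.
  apply: (le_trans (positive_op_CS (conj Ssym Spos) AhS gS)).
  by rewrite ler_piMl// addr_ge0// Spos.
have q0 := ii.1; have bP := product_form_pos domBA q0.
have clos' := product_form_closable q0 (clos ii).
exists (form_op bP clos'); split.
- exact: form_op_positive.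
- exact: form_op_selfadjoint.
have SAB h : dom B h -> form_graph (dom_fun B) (product_form A B) (A h) (B h).
  move=> hB; have [k kh] := dom_type_of hB; rewrite -kh.
  apply: form_graph_id => // k'.
  (* Symmetry makes the two halves of the symmetrized form equal, so that T^* sends [A h] to the
     class of [h]. *)
  rewrite /product_form -(product_symmetric domBA q0 rs) ?kh//; last first.
    exact: dom_dom_val.
  by rewrite /dom_fun; field.
split=> [h hB|h hB]; first by split; [exact: domBA | exists (B h); exact: SAB].
exact/form_op_funE/SAB.
Qed.
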